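(* Let $p$ be an odd prime and let $G_{g\,\mathsf{PR},\,h\,\mathsf{ANY}}(p)$ denote the number of integers $h$ with $1\le h\le p-1$ for which there exists a primitive root $g$ modulo $p$, $1\le g\le p-1$, with $g^{h}\equiv h\pmod p$. Then \[ \left|G_{g\,\mathsf{PR},\,h\,\mathsf{ANY}}(p)-\frac{1}{p-1}\sum_{e\mid p-1}\phi\!\left(\frac{p-1}{e}\right)^{2}\right|\le d(p-1)^{3}\sqrt{p}\,(1+\ln p). \]
   Context: $\phi$ is Euler's totient function, $d(n)$ denotes the number of positive divisors of $n$, the sum runs over positive divisors $e$ of $p-1$, and $\ln$ is the natural logarithm. *)

(* Defs.v *)
From Stdlib Require Import Reals.
From mathcomp Require Import all_boot.

Set Implicit Arguments.
Unset Strict Implicit.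
Unset Printing Implicit Defensive.

Definition prim_root (p g : nat) : bool :=
  [&& coprime g p, (expn g (p - 1) %% p == 1 %% p)
    & [forall k : 'I_(p - 1), (0 < k) ==> (expn g k %% p != 1)]].

Definition G_PR_ANY (p : nat) : nat :=
  #|[set h : 'I_p | (0 < h) &&
      [exists g : 'I_p, (0 < g) && prim_root p g && (expn g h == h %[mod p])]]|.

Definition numdiv (n : nat) : nat := size (divisors n).

Definition main_term (p : nat) : R :=
  Rmult (Rinv (INR (p - 1)))
        (INR (\sum_(e <- divisors (p - 1)) expn (totient ((p - 1) %/ e)) 2)).

(* Main.v *)
Require Import Defs.
From Stdlib Require Import Reals Lra.
From mathcomp Require Import all_boot.
From mathcomp Require Import all_order all_algebra cyclic finfield complex.
From mathcomp Require Import Rstruct ring zify.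

Set Implicit Arguments.
Unset Strict Implicit.
Unset Printing Implicit Defensive.

Import Order.TTheory GRing.Theory Num.Theory.

(** Put n = p - 1 and fix a primitive root w modulo p. Since g^h runs over all
    elements of order n / gcd(n, h) when g runs over the primitive roots, h is
    counted iff gcd(n, h) = gcd(n, ind h), where h = w^(ind h). For each e | n,
    Moebius inversion writes the indicators of gcd(n, h) = e and of
    gcd(n, ind h) = e as signed sums of indicators of u | h and of v | ind h,
    so it suffices to show that the number of multiples h = u i of u in [1, n]
    with v | ind h, i.e. lying in the subgroup H of order r = n / v of F_p^*,
    is (n/u)(n/v)/n up to an error sqrt p (1 + ln p). This is a
    Polya-Vinogradov bound: the function 1_H - (r/n) 1_{F_p^*} has Fourier
    coefficient 0 at 0 and, by Parseval and H-invariance, coefficients of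
    modulus at most sqrt p elsewhere, while the geometric sums over i are at
    most 1 / sin (PI b / p) <= (p / 2) (1 / b + 1 / (p - b)). *)

(** * Elementary inequalities for sin and ln *)

Section RealInequalities.
Local Open Scope R_scope.

(* Concavity: the slope of sin over [0, x] is at least its slope over [x, PI/2]. *)
Lemma jordan_sin (x : R) : 0 < x -> x <= PI / 2 -> 2 * x <= PI * sin x.
Proof.
move=> x_gt0; case=> [x_lt|->]; last by rewrite sin_PI2; lra.
have [c1 [eq1 c1_in]] := MVT_cor2 sin cos 0 x x_gt0 (fun c _ => derivable_pt_lim_sin c).
have [c2 [eq2 c2_in]] := MVT_cor2 sin cos x (PI / 2) x_lt (fun c _ => derivable_pt_lim_sin c).
have cos_le : cos c2 <= cos c1 by apply: cos_decr_1; lra.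
rewrite sin_0 in eq1; rewrite sin_PI2 in eq2.
have : sin x * (PI / 2 - x) >= (1 - sin x) * x.
  rewrite eq2 (_ : sin x = cos c1 * x); last by lra.
  have := Rmult_le_compat_r (x * (PI / 2 - x)) _ _ _ cos_le.
  have := Rmult_lt_0_compat x (PI / 2 - x); nra.
nra.
Qed.

(** Jordan's inequality bounds the left side by 1 / (2 x) when x <= 1/2, and the reflection x -> 1 -
    x covers the rest. The other summand is positive; keeping both makes the bound uniform in x. *)
Lemma inv_sin_PI_le (x : R) : 0 < x -> x < 1 ->
  / sin (PI * x) <= / 2 * (/ x + / (1 - x)).
Proof.
have half y : 0 < y -> y <= / 2 -> / sin (PI * y) <= / 2 * / y.
  move=> y_gt0 y_le; have PI_pos := PI_RGT_0.
  have : 2 * (PI * y) <= PI * sin (PI * y) by apply: jordan_sin; nra.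
  move=> le_sin; rewrite -Rinv_mult; apply: Rinv_le_contravar; nra.
move=> x_gt0 x_lt1; have invx := Rinv_0_lt_compat _ x_gt0.
have inv1x : 0 < / (1 - x) by apply: Rinv_0_lt_compat; lra.
have [x_le|x_ge] := Rle_dec x (/ 2).
  by have := half x x_gt0 x_le; lra.
rewrite -sin_PI_x (_ : PI - PI * x = PI * (1 - x)); last by lra.
by have := half (1 - x); lra.
Qed.

Lemma ln_le_sub1 (x : R) : 0 < x -> ln x <= x - 1.
Proof. by move=> x_gt0; have := exp_ineq1_le (ln x); rewrite exp_ln //; lra. Qed.

(** This is ln y <= y - 1 at y = x / (x + 1); it telescopes in [harmonic_le]. *)
Lemma inv_succ_le_ln (x : R) : 0 < x -> / (x + 1) <= ln (x + 1) - ln x.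
Proof.
move=> x_gt0; have x1_gt0 : 0 < / (x + 1) by apply: Rinv_0_lt_compat; lra.
have := ln_le_sub1 (Rmult_lt_0_compat _ _ x_gt0 x1_gt0).
rewrite ln_mult ?ln_Rinv; try lra.
have : (x + 1) * / (x + 1) = 1 by apply: Rinv_r; lra.
lra.
Qed.

End RealInequalities.


Local Open Scope ring_scope.

Lemma inv_sin_PI_ler (x : R) : 0 < x -> x < 1 ->
  (sin (PI * x))^-1 <= 2^-1 * (x^-1 + (1 - x)^-1).
Proof.
move=> /RltP x_gt0 /RltP x_lt1; apply/RleP.
have two : 2%:R = IZR 2 :> R by rewrite -INRE.
by rewrite two; apply: inv_sin_PI_le.
Qed.

Lemma harmonic_le (m : nat) : (0 < m)%N ->
  \sum_(1 <= b < m.+1) b%:R^-1 <= 1 + ln m%:R :> R.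
Proof.
elim: m => // -[_ _|m IHm _].
  by rewrite big_nat1 invr1 -[1%:R]/R1 ln_1 addr0.
rewrite big_nat_recr //=; apply: le_trans (lerD (IHm isT) (lexx _)) _.
rewrite -addrA lerD2l -lerBrDl.
have m_gt0 : Rlt 0 m.+1%:R by apply/RltP; rewrite ltr0n.
have /RleP := inv_succ_le_ln m_gt0.
by rewrite RplusE RinvE natr1 RminusE.
Qed.

Lemma harmonic_lt_le (m : nat) : (1 < m)%N ->
  \sum_(1 <= b < m) b%:R^-1 <= 1 + ln m%:R :> R.
Proof.
case: m => [|m] // m_gt0; apply: le_trans (harmonic_le m_gt0) _.
rewrite lerD2l; apply/RleP; left; apply: ln_increasing; apply/RltP.
  by rewrite ltr0n.
by rewrite ltr_nat.
Qed.

(** * Points of the unit circle and their geometric sums *)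

Section ComplexExponential.

Local Open Scope complex_scope.

Definition expi (t : R) : R[i] := Complex (cos t) (sin t).

Lemma expiD s t : expi (s + t) = expi s * expi t.
Proof. by rewrite /expi cosD sinD [sin s * _ + _]addrC. Qed.

Lemma expiX t k : expi t ^+ k = expi (t *+ k).
Proof.
elim: k => [|k IHk]; first by rewrite expr0 mulr0n /expi cos_0 sin_0.
by rewrite exprS IHk mulrS expiD.
Qed.

Lemma norm_expi t : `|expi t| = 1.
Proof.
rewrite normc_def /= addrC; have := sin2_cos2 t; rewrite /Rsqr RplusE !RmultE -!expr2 => ->.
by rewrite sqrtr1.
Qed.

Lemma norm_1_sub_expi t : `|1 - expi (t *+ 2)| = `|2 * sin t|%:C.
Proof.
rewrite normc_def /= -sqrtr_sqr; congr (Num.sqrt _)%:C.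
have := sin2_cos2 t; rewrite /Rsqr RplusE !RmultE => sc.
(* Replacing 1 by sin^2 + cos^2 here, and inserting one such factor on the right, makes both sides
   homogeneous of degree 4, so that [ring] applies. *)
rewrite mulr2n cosD sinD sub0r sqrrN -[X in (X - _) ^+ 2]sc.
transitivity ((2 * sin t) ^+ 2 * (sin t * sin t + cos t * cos t)); last first.
  by rewrite sc mulr1.
by ring.
Qed.

(* Telescoping gives (1 - e(t)) sum_i e(i t) = e(t) - e((M + 1) t), of norm at most 2. *)
Lemma norm_geometric_sum_le (t : R) (M : nat) : 0 < sin t ->
  `|\sum_(1 <= i < M.+1) expi (t *+ 2) ^+ i| <= ((sin t)^-1)%:C.
Proof.
move=> sin_gt0; set y := expi _.
have two_sin_gt0 : 0 < 2 * sin t by rewrite mulr_gt0.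
have norm_1y : `|1 - y| = (2 * sin t)%:C.
  by rewrite norm_1_sub_expi gtr0_norm.
have norm_gt0: 0 < `|1 - y| by rewrite norm_1y ltcR.
have -> : (sin t)^-1%:C = 2 / `|1 - y|.
  rewrite norm_1y rmorphM rmorph_nat invfM mulrA divff ?mul1r ?fmorphV //.
  by rewrite pnatr_eq0.
rewrite ler_pdivlMr // -normrM.
have -> : (\sum_(1 <= i < M.+1) y ^+ i) * (1 - y) = y - y ^+ M.+1.
  rewrite mulrC; elim: M => [|M IHM]; first by rewrite big_geq // mulr0 subrr.
  by rewrite big_nat_recr //= mulrDr IHM mulrBl mul1r -exprS addrA addrNK.
apply: le_trans (ler_normB _ _) _.
by rewrite normrX norm_expi expr1n.
Qed.

End ComplexExponential.

(** * Fourier analysis on a finite field *)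

Section Fourier.

Variables (F : finFieldType) (C : numClosedFieldType) (psi : F -> C).
Hypothesis psiD : forall x y, psi (x + y) = psi x * psi y.
Hypothesis norm_psi : forall x, `|psi x| = 1.
Hypothesis sum_psi : \sum_x psi x = 0.

Definition fourier (g : F -> C) (a : F) : C := \sum_x g x * psi (a * x).

Lemma psi0 : psi 0 = 1.
Proof.
have psi0_neq0: psi 0 != 0 by rewrite -normr_gt0 norm_psi.
by apply: (mulfI psi0_neq0); rewrite -psiD addr0 mulr1.
Qed.

Lemma conj_psi x : (psi x)^* = psi (- x).
Proof.
have psix_neq0: psi x != 0 by rewrite -normr_gt0 norm_psi.
by apply: (mulfI psix_neq0); rewrite -normCK norm_psi expr1n -psiD subrr psi0.
Qed.

(** For b != 0 the map a -> a b permutes F, so the sum is that of psi. *)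
Lemma sum_psi_mul b : \sum_a psi (a * b) = #|F|%:R * (b == 0)%:R.
Proof.
have [->|b_neq0] := eqVneq b 0.
  rewrite mulr1 (eq_bigr (fun=> 1)) ?sumr_const //.
  by move=> a _; rewrite mulr0 psi0.
rewrite mulr0 -[RHS]sum_psi [RHS](reindex_onto (fun a => a * b) (fun a => a / b)).
  by apply: eq_bigl => a; rewrite mulfK ?eqxx.
by move=> a _; rewrite divfK.
Qed.

Lemma fourier_inversion g x :
  \sum_a fourier g a * psi (- (a * x)) = #|F|%:R * g x.
Proof.
under eq_bigr do rewrite mulr_suml.
rewrite exchange_big (bigD1 x) //= [X in _ + X]big1 => [|y y_neq_x].
  rewrite addr0 (eq_bigr (fun=> g x)) ?sumr_const ?mulr_natl // => a _.
  by rewrite -mulrA -psiD subrr psi0 mulr1.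
under eq_bigr do rewrite -mulrA -psiD -mulrBr.
by rewrite -mulr_sumr sum_psi_mul subr_eq0 (negPf y_neq_x) !mulr0.
Qed.

Lemma parseval g : \sum_a `|fourier g a| ^+ 2 = #|F|%:R * \sum_x `|g x| ^+ 2.
Proof.
have conj_fourier a : (fourier g a)^* = \sum_x (g x)^* * psi (- (a * x)).
  by rewrite rmorph_sum; apply: eq_bigr => x _; rewrite rmorphM /= conj_psi.
under eq_bigr do rewrite normCK conj_fourier mulr_sumr.
rewrite exchange_big mulr_sumr; apply: eq_bigr => x _.
under eq_bigr do rewrite mulrCA.
by rewrite -mulr_sumr fourier_inversion normCK mulrCA [_^* * _]mulrC.
Qed.

(* By invariance |ghat|^2 takes the same value on the #|H| points of H a, and
   Parseval bounds the sum of these values. *)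
Lemma fourier_invariant_le (H : {set F}) g a :
    0 \notin H -> (forall y x, y \in H -> g (y * x) = g x) -> a != 0 ->
  #|H|%:R * `|fourier g a| ^+ 2 <= #|F|%:R * \sum_x `|g x| ^+ 2.
Proof.
move=> H0 gH a_neq0; rewrite -parseval.
have fourierH y : y \in H -> fourier g (a * y) = fourier g a.
  move=> yH; have y_neq0: y != 0 by apply: contraNneq H0 => <-.
  rewrite [RHS]/fourier (reindex_onto (fun x => y * x) (fun x => y^-1 * x)) /=.
    rewrite (eq_bigl xpredT); last by move=> x; rewrite mulKf ?eqxx.
    by apply: eq_bigr => x _; rewrite gH // mulrA.
  by move=> x _; rewrite mulVKf.
have inj_a : {in H &, injective (fun y => a * y)} by move=> x y _ _; apply: mulfI.
rewrite mulr_natl -sumr_const.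
rewrite (eq_bigr (fun y => `|fourier g (a * y)| ^+ 2)); last first.
  by move=> y yH; rewrite fourierH.
rewrite -(big_imset (fun b => `|fourier g b| ^+ 2) inj_a) /=.
rewrite [leRHS](bigID (mem [set a * y | y in H])) /= lerDl.
by apply: sumr_ge0 => b _; apply: exprn_ge0.
Qed.

(** Completion of an incomplete sum: Fourier inversion expands each g (f i) over the frequencies,
    the frequency 0 contributes nothing, and the sign in psi (- (a * f i)) is absorbed by a -> -
    a. *)
Lemma sum_fourier_le (I : Type) (r : seq I) (f : I -> F) g (B : C) :
    fourier g 0 = 0 -> (forall a, a != 0 -> `|fourier g a| <= B) ->
  #|F|%:R * `|\sum_(i <- r) g (f i)|
    <= B * \sum_(a | a != 0) `|\sum_(i <- r) psi (a * f i)|.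
Proof.
move=> g0 gB; rewrite -[#|F|%:R]normr_nat -normrM mulr_sumr.
under eq_bigr do rewrite -fourier_inversion.
rewrite exchange_big /= (bigD1 0) //= big1 ?add0r => [|i _]; last first.
  by rewrite g0 mul0r.
apply: le_trans (ler_norm_sum _ _ _) _.
have ->: \sum_(a | a != 0) `|\sum_(i <- r) psi (a * f i)| =
    \sum_(a | a != 0) `|\sum_(i <- r) psi (- (a * f i))|.
  rewrite (reindex_inj oppr_inj) /=; apply: eq_big => [a|a _].
    by rewrite oppr_eq0.
  by under eq_bigr do rewrite mulNr.
rewrite mulr_sumr; apply: ler_sum => a a_neq0.
by rewrite -mulr_sumr normrM ler_wpM2r ?normr_ge0 // gB.
Qed.

End Fourier.

(** * Sieving by greatest common divisors *)

Section Sieve.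

Variable R : numDomainType.

(** Induction on s. A further prime q multiplies the indicator by 1 minus the indicator of q | k, so
    t gains the products q d with coefficient - c d. The t built this way consists of the products
    of subsets of s, and c is the Moebius function on it. *)
Lemma prime_sieve (s : seq nat) : uniq s -> all prime s ->
  exists (t : seq nat) (c : nat -> R),
    [/\ uniq t,
        {in t, forall d, forall m, all (dvdn^~ m) s -> d %| m}%N,
        {in t, forall d q, q %| d -> prime q -> q \in s}%N,
        forall d, `|c d| <= 1
      & forall k, (~~ has (dvdn^~ k) s)%:R = \sum_(d <- t) c d * (d %| k)%:R].
Proof.
elim: s => [_ _|q s IHs /= /andP[q_notin s_uniq] /andP[q_pr s_pr]].
  exists [:: 1%N], (fun=> 1); split=> //= [d||d|k].
  - by rewrite inE => /eqP-> m _; rewrite dvd1n.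
  - by move=> d; rewrite inE => /eqP-> q; rewrite dvdn1 => /eqP->.
  - by rewrite normr1.
  - by rewrite big_seq1 dvd1n mulr1.
have [t [c [t_uniq t_dvd t_primes c_le1 sieve]]] := IHs s_uniq s_pr.
have q_gt0 := prime_gt0 q_pr.
have q_ndvd d : d \in t -> ~~ (q %| d)%N.
  by move=> dt; apply: contraNN q_notin => /(t_primes d dt); apply.
have q_coprime d : d \in t -> coprime q d by move=> dt; rewrite prime_coprime ?q_ndvd.
exists (t ++ [seq q * d | d <- t]%N).
(* Divisibility by q separates the new entries from the old ones, since q divides no d in t. *)
exists (fun d => if (q %| d)%N then - c (d %/ q)%N else c d); split.
- rewrite cat_uniq t_uniq map_inj_uniq ?t_uniq ?andbT; last first.
    by move=> x y /eqP; rewrite eqn_pmul2l // => /eqP.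
  apply/hasPn => _ /mapP[d dt ->]; apply/negP => /q_ndvd.
  by rewrite dvdn_mulr.
- move=> d; rewrite mem_cat => /orP[dt|/mapP[e et ->]] m /andP[qm sm].
    exact: t_dvd.
  by rewrite Gauss_dvd ?q_coprime // qm t_dvd.
- move=> d; rewrite mem_cat => /orP[dt|/mapP[e et ->]] r rd r_pr.
    by rewrite inE (t_primes d dt) ?orbT.
  rewrite Euclid_dvdM // dvdn_prime2 // in rd; rewrite inE.
  by case/orP: rd => [->//|re]; rewrite (t_primes e et) ?orbT.
- by move=> d; case: ifP => _; rewrite ?normrN.
move=> k; rewrite big_cat big_map /= negb_or -mulnb natrM sieve mulr_sumr.
rewrite -big_split /=; apply: eq_big_seq => d dt.
rewrite (negPf (q_ndvd d dt)) dvdn_mulr // mulKn // Gauss_dvd ?q_coprime //.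
by case: (q %| k)%N; rewrite /= ?mul1r ?mul0r ?mulr0 ?addr0 // mulNr subrr.
Qed.

Lemma coprime_sieve (m : nat) : (0 < m)%N ->
  exists (t : seq nat) (c : nat -> R),
    [/\ uniq t, {in t, forall d, d %| m}%N, forall d, `|c d| <= 1
      & forall k, (coprime m k)%:R = \sum_(d <- t) c d * (d %| k)%:R].
Proof.
move=> m_gt0; have [|t [c [t_uniq t_dvd _ c_le1 sieve]]] :=
  prime_sieve (primes_uniq m); first by apply/allP => q; rewrite mem_primes => /andP[].
exists t, c; split=> // [d dt|k].
  by apply: t_dvd => //; apply/allP => q; rewrite mem_primes => /and3P[].
rewrite -sieve; congr ((_ : bool)%:R).
apply/idP/hasPn => [mk q|mk].
  rewrite mem_primes => /and3P[q_pr _ qm].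
  rewrite -prime_coprime //; exact: coprime_dvdl mk.
rewrite /coprime; apply: contraT => gcd_neq1.
have gcd_gt1: (1 < gcdn m k)%N by rewrite ltn_neqAle eq_sym gcd_neq1 gcdn_gt0 m_gt0.
have /andP[qm qk]: (pdiv (gcdn m k) %| m)%N && (pdiv (gcdn m k) %| k)%N.
  by rewrite -dvdn_gcd pdiv_dvd.
have := mk (pdiv (gcdn m k)); rewrite qk mem_primes pdiv_prime // m_gt0 qm.
by move=> /(_ isT).
Qed.

Lemma count_dvdn d m : (0 < d)%N -> (d %| m)%N ->
  \sum_(0 <= k < m) (d %| k)%:R = (m %/ d)%:R :> R.
Proof.
move=> d_gt0 /dvdnP[r ->]; rewrite mulnK //; elim: r => [|r IHr].
  by rewrite mul0n big_nil.
rewrite mulSnr (big_cat_nat (n := (r * d)%N)) ?leq_addr //= IHr.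
rewrite -[X in index_iota X]add0n big_addn addKn.
case: d d_gt0 {IHr} => // d _.
rewrite big_nat_recl //= dvdn_mull // big1_seq => [|i]; last first.
  rewrite mem_index_iota /= addnC dvdn_addr ?dvdn_mull // => /= i_lt.
  by rewrite gtnNdvd.
by rewrite addr0 -natr1.
Qed.

(** With n = m e, gcd(n, k) = e iff k = j e for some j coprime to m, so [coprime_sieve] for m
    applies to j. The last clause sums that sieve over k < m; having the same coefficients, it lets
    the main terms recombine into totients. *)
Lemma gcdn_sieve (n e : nat) : (0 < n)%N -> (e %| n)%N ->
  exists (t : seq nat) (c : nat -> R),
    [/\ (size t <= size (divisors n))%N, {in t, forall d, d * e %| n}%N,
        forall d, `|c d| <= 1,
        forall k, (gcdn n k == e)%:R = \sum_(d <- t) c d * (d * e %| k)%:R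
      & (totient (n %/ e))%:R = \sum_(d <- t) c d * (n %/ (d * e))%:R].
Proof.
move=> n_gt0 /dvdnP[m n_def]; rewrite {}n_def in n_gt0 *.
have /andP[m_gt0 e_gt0] : (0 < m)%N && (0 < e)%N by rewrite -muln_gt0.
have [t [c [t_uniq t_dvd c_le1 sieve]]] := coprime_sieve m_gt0.
exists t, c; split=> // [|d dt|k|].
- apply: uniq_leq_size => // d dt; rewrite -dvdn_divisors //.
  by rewrite dvdn_mulr ?t_dvd.
- by rewrite dvdn_pmul2r ?t_dvd.
- have [/dvdnP[j ->]|e_ndvd] := boolP (e %| k)%N.
    rewrite -muln_gcdl -{2}[e]mul1n eqn_pmul2r // -/(coprime m j) sieve.
    by apply: eq_bigr => d _; rewrite dvdn_pmul2r.
  have /negPf->: gcdn (m * e) k != e.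
    by apply: contraNneq e_ndvd => <-; apply: dvdn_gcdr.
  rewrite big1 // => d _; rewrite (_ : (d * e %| k)%N = false) ?mulr0 //.
  by apply: contraNF e_ndvd; apply: dvdn_trans; apply: dvdn_mull.
- rewrite mulnK // totient_count_coprime natr_sum.
  under eq_bigr do rewrite sieve.
  rewrite exchange_big; apply: eq_big_seq => d dt /=.
  have d_gt0: (0 < d)%N by apply: dvdn_gt0 (t_dvd d dt).
  by rewrite -mulr_sumr count_dvdn ?t_dvd // divnMr.
Qed.

End Sieve.

(** * Counting equal gcds under an equidistribution hypothesis *)

Section EqualGcd.

Variables (R : numFieldType) (n : nat) (ind : nat -> nat) (E : R).
Hypothesis n_gt0 : (0 < n)%N.
Hypothesis dvdn_pair_equidistributed : forall u v, (u %| n)%N -> (v %| n)%N ->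
  `|\sum_(1 <= h < n.+1) (u %| h)%:R * (v %| ind h)%:R
      - (n %/ u)%:R * (n %/ v)%:R / n%:R| <= E.

(** Both indicators are expanded by the same sieve. The main terms factor into a square of totients,
    and each of the at most d(n)^2 pairs of sieve terms costs E because the coefficients have
    modulus at most 1. *)
Lemma card_gcdn_pair e : (e %| n)%N ->
  `|\sum_(1 <= h < n.+1) (gcdn n h == e)%:R * (gcdn n (ind h) == e)%:R
      - (totient (n %/ e))%:R ^+ 2 / n%:R| <= (size (divisors n))%:R ^+ 2 * E.
Proof.
move=> en; have [t [c [t_size t_dvd c_le1 sieve tot]]] := gcdn_sieve R n_gt0 en.
pose err u v := \sum_(1 <= h < n.+1) (u %| h)%:R * (v %| ind h)%:R
      - (n %/ u)%:R * (n %/ v)%:R / n%:R : R.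
rewrite [X in `|X|](_ : _ =
    \sum_(d <- t) \sum_(f <- t) c d * c f * err (d * e)%N (f * e)%N); last first.
  rewrite expr2 {1 2}tot big_distrlr mulr_suml /=.
  rewrite (eq_bigr (fun h => \sum_(d <- t) \sum_(f <- t)
     c d * c f * ((d * e %| h)%:R * (f * e %| ind h)%:R))) => [|h _]; last first.
    rewrite !sieve big_distrlr; apply: eq_bigr => d _; apply: eq_bigr => f _ /=.
    by rewrite mulrACA.
  rewrite exchange_big -sumrB; apply: eq_bigr => d _.
  rewrite exchange_big mulr_suml -sumrB; apply: eq_bigr => f _ /=.
  by rewrite -mulr_sumr mulrACA -[_ / _]mulrA -mulrBr.
(* Nonnegativity of E is what allows [size t] to be replaced by the number of divisors at the
   end. *)
have E_ge0 : 0 <= E := le_trans (normr_ge0 _) (dvdn_pair_equidistributed en en).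
have term_le d f : d \in t -> f \in t ->
    `|c d * c f * err (d * e)%N (f * e)%N| <= E.
  move=> dt ft; rewrite !normrM -[leRHS]mul1r ler_pM ?mulr_ge0 //.
    by rewrite -[leRHS]mul1r ler_pM.
  by rewrite dvdn_pair_equidistributed ?t_dvd.
have sum_le_size (F : nat -> R) (B : R) : {in t, forall d, F d <= B} ->
    \sum_(d <- t) F d <= (size t)%:R * B.
  rewrite big_seq => F_le; apply: le_trans (ler_sum _ F_le) _.
  by rewrite -big_seq big_const_seq count_predT iter_addr_0 mulr_natl.
apply: le_trans (_ : (size t)%:R ^+ 2 * E <= _); last first.
  by rewrite ler_wpM2r // ler_pXn2r ?qualifE /= ?ler0n // ler_nat.
apply: le_trans (ler_norm_sum _ _ _) _; rewrite expr2 -mulrA.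
apply: (sum_le_size _ _ _) => d dt; apply: le_trans (ler_norm_sum _ _ _) _.
by apply: sum_le_size => f ft; apply: term_le.
Qed.

(** The count is split by the common gcd e. Each of the d(n) divisors costs d(n)^2 E, whence the
    cube. *)
Lemma card_equal_gcdn :
  `|\sum_(1 <= h < n.+1) (gcdn n h == gcdn n (ind h))%:R
      - n%:R^-1 * (\sum_(e <- divisors n) totient (n %/ e) ^ 2)%N%:R|
    <= (size (divisors n))%:R ^+ 3 * E.
Proof.
have split_gcd h : (gcdn n h == gcdn n (ind h))%:R =
    \sum_(e <- divisors n) (gcdn n h == e)%:R * (gcdn n (ind h) == e)%:R :> R.
  rewrite (bigD1_seq (gcdn n h)) ?divisors_uniq //=; last first.
    by rewrite -dvdn_divisors ?dvdn_gcdl.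
  rewrite eqxx mul1r big1 ?addr0 1?eq_sym // => e.
  by rewrite eq_sym => /negPf->; rewrite mul0r.
rewrite (eq_bigr _ (fun h _ => split_gcd h)).
rewrite exchange_big natr_sum mulr_sumr -sumrB /=.
apply: le_trans (ler_norm_sum _ _ _) _.
have le_e e : e \in divisors n -> _ := fun en => card_gcdn_pair
   (etrans (dvdn_divisors _ n_gt0) en).
have ->: (size (divisors n))%:R ^+ 3 * E =
    \sum_(e <- divisors n) (size (divisors n))%:R ^+ 2 * E.
  by rewrite big_const_seq count_predT iter_addr_0 exprS -mulrA mulr_natl.
rewrite big_seq [leRHS]big_seq; apply: ler_sum => e en.
by rewrite natrX [_^-1 * _]mulrC le_e.
Qed.

End EqualGcd.

(** * Discrete logarithms *)

(** Units modulo m lift to units modulo n. With s the product of the primes of n not dividing a,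
    every prime factor of n divides exactly one of a and m s, hence not their sum. *)
Lemma coprime_lift (n m a : nat) : (0 < n)%N -> (m %| n)%N -> coprime a m ->
  exists s, coprime (a + m * s) n.
Proof.
move=> n_gt0 mn am; exists (\prod_(q <- primes n | ~~ (q %| a)) q)%N.
rewrite /coprime; apply: contraT => gcd_neq1; set s := (\prod_(_ <- _ | _) _)%N in gcd_neq1.
have gcd_gt1: (1 < gcdn (a + m * s) n)%N.
  by rewrite ltn_neqAle eq_sym gcd_neq1 gcdn_gt0 n_gt0 orbT.
set q := pdiv (gcdn (a + m * s) n); have q_pr: prime q by apply: pdiv_prime.
have /andP[qs qn]: (q %| a + m * s)%N && (q %| n)%N by rewrite -dvdn_gcd pdiv_dvd.
have q_dvd_s : (q %| s)%N = ~~ (q %| a)%N.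
  rewrite Euclid_dvd_prod // big_has_cond; apply/hasP/idP => [[r]|qa].
    rewrite mem_primes => /and3P[r_pr _ _] /andP[ra].
    by rewrite dvdn_prime2 // => /eqP->.
  by exists q; [rewrite mem_primes q_pr n_gt0 | rewrite /= qa dvdnn].
have [qa|qa] := boolP (q %| a)%N.
  move: qs; rewrite dvdn_addr // Euclid_dvdM // q_dvd_s qa orbF => qm.
  have: (q %| gcdn a m)%N by rewrite dvdn_gcd qa.
  by rewrite (eqP am) dvdn1 => /eqP q1; rewrite q1 in q_pr.
by rewrite dvdn_addl ?(negPf qa) // in qs; rewrite dvdn_mull // q_dvd_s qa.
Qed.

(** Dividing n, h, j by the common gcd leaves m, k, l with k and l units modulo m. If u inverts k
    modulo m, then u l is a unit modulo m carrying k to l, and [coprime_lift] raises it to a unit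
    modulo n. *)
Lemma gcdn_eq_unit_mul (n h j : nat) : (0 < n)%N -> (0 < h)%N ->
  gcdn n h = gcdn n j -> exists2 t, coprime t n & t * h = j %[mod n].
Proof.
move=> n_gt0 h_gt0 gcd_eq; pose e := gcdn n h.
have e_gt0: (0 < e)%N by rewrite gcdn_gt0 n_gt0.
have /dvdnP[m n_def]: (e %| n)%N by apply: dvdn_gcdl.
have /dvdnP[k h_def]: (e %| h)%N by apply: dvdn_gcdr.
have /dvdnP[l j_def]: (e %| j)%N by rewrite /e gcd_eq dvdn_gcdr.
have mk: coprime m k.
  by rewrite /coprime -(eqn_pmul2r e_gt0) muln_gcdl -n_def -h_def mul1n.
have ml: coprime m l.
  by rewrite /coprime -(eqn_pmul2r e_gt0) muln_gcdl -n_def -j_def mul1n -gcd_eq.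
have k_gt0: (0 < k)%N by rewrite h_def muln_gt0 in h_gt0; case/andP: h_gt0.
have [[u v] /= uv] : exists u, (u.1 * k - u.2 * m)%N = 1%N.
  by apply/coprimeP; rewrite // coprime_sym.
have uk : (u * k = v * m + 1)%N by lia.
have um : coprime u m.
  have: coprime (u * k) m by rewrite uk coprime_sym /coprime gcdnMDl gcdn1.
  by rewrite coprimeMl => /andP[].
have [||s sP] := @coprime_lift n m (u * l) n_gt0.
- by rewrite n_def dvdn_mulr.
- by rewrite coprimeMl um coprime_sym.
exists (u * l + m * s)%N => //; apply/eqP.
have ->: ((u * l + m * s) * h = (v * l + s * k) * n + j)%N.
  have: (u * l * k = l * (v * m + 1))%N by rewrite -uk mulnCA mulnA.
  rewrite {1}h_def {1}n_def {1}j_def; nia.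
by rewrite modnMDl.
Qed.

Lemma divn_inj_dvd (n a b : nat) : (0 < n)%N -> (a %| n)%N -> (b %| n)%N ->
  (n %/ a = n %/ b)%N -> a = b.
Proof.
move=> n_gt0 an bn nab; have a_gt0: (0 < n %/ a)%N.
  by rewrite divn_gt0 ?(dvdn_leq n_gt0) ?(dvdn_gt0 n_gt0).
by apply/eqP; rewrite -(eqn_pmul2l a_gt0) {2}nab !divnK.
Qed.

(** [index] makes this total: the default value [#|F|] is returned when x is not a power of w, a
    case that [dlogK] excludes. *)
Definition dlog (F : finFieldType) (w x : F) : nat :=
  index x [seq w ^+ i | i <- iota 0 #|F|].

Lemma dlogK (F : finFieldType) (w x : F) :
  #|F|.-1.-primitive_root w -> x != 0 -> w ^+ dlog w x = x.
Proof.
move=> w_prim x_neq0; have F_gt0: (0 < #|F|)%N by apply/card_gt0P; exists 0.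
have x_mem: x \in [seq w ^+ i | i <- iota 0 #|F|].
  have [|i ->] := prim_rootP w_prim (x := x).
    by apply: (mulfI x_neq0); rewrite -exprS prednK // expf_card mulr1.
  apply/mapP; exists (val i) => //; rewrite mem_iota /= add0n.
  exact: leq_trans (ltn_ord i) (leq_pred _).
rewrite /dlog -[RHS](nth_index 0 x_mem).
rewrite -index_mem size_map size_iota in x_mem.
by rewrite (nth_map 0%N) ?size_iota // nth_iota.
Qed.

Lemma exists_prim_root (F : finFieldType) : (1 < #|F|)%N ->
  exists w : F, #|F|.-1.-primitive_root w.
Proof.
move=> F_gt1; have n_gt0: (0 < #|F|.-1)%N by rewrite -subn1 subn_gt0.
have := @has_prim_root F _ (enum [pred x : F | x != 0]) n_gt0.
case/(_ _ _ _)/hasP => [||| w _ w_prim]; last by exists w.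
- apply/allP => x; rewrite mem_enum inE => x_neq0; apply/unity_rootP.
  by apply: (mulfI x_neq0); rewrite -exprS prednK ?expf_card ?mulr1 // ltnW.
- exact: enum_uniq.
- by rewrite -cardE -(cardC1 (0 : F)); apply/subset_leq_card/subsetP => x; rewrite !inE.
Qed.

(** Translates divisibility of a discrete logarithm by d into membership in the group of (n / d)-th
    roots of unity. *)
Lemma dvdn_expr_eq1 (R : nzRingType) (n d i : nat) (w : R) :
    (0 < n)%N -> (d %| n)%N -> n.-primitive_root w ->
  (d %| i)%N = ((w ^+ i) ^+ (n %/ d) == 1).
Proof.
move=> n_gt0 /dvdnP[m n_def] w_prim; rewrite -exprM -(prim_order_dvd w_prim).
rewrite {}n_def in n_gt0 *; rewrite muln_gt0 in n_gt0.
case/andP: n_gt0 => m_gt0 d_gt0.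
by rewrite mulnK // [(m * d)%N]mulnC dvdn_pmul2r.
Qed.

Section PrimeField.

Variable p : nat.
Hypothesis p_pr : prime p.

Lemma eqr_Fp_nat (a b : nat) : (a%:R == b%:R :> 'F_p) = (a == b %[mod p]).
Proof. by rewrite -val_eqE /= !val_Fp_nat. Qed.

Lemma prim_rootE (g : nat) :
  prim_root p g = p.-1.-primitive_root (g%:R : 'F_p).
Proof.
have n_gt0: (0 < p - 1)%N by rewrite subn_gt0 prime_gt1.
have exprE k : (g ^ k %% p == 1)%N = ((g%:R : 'F_p) ^+ k == 1).
  by rewrite -natrX -[1]/(1%:R) eqr_Fp_nat [(1 %% p)%N]modn_small ?prime_gt1.
rewrite -subn1 /prim_root [(1 %% p)%N]modn_small ?prime_gt1 // exprE.
apply/idP/idP => [/and3P[_ /eqP gn /forallP g_ord]|g_prim].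
  (* The exact order m divides p - 1; if it were smaller, the minimality clause of [prim_root] at k
     = m would fail. *)
  have [m m_prim mn] := prim_order_exists n_gt0 gn.
  have := dvdn_leq n_gt0 mn; rewrite leq_eqVlt => /orP[/eqP<- //|m_lt].
  have := g_ord (Ordinal m_lt).
  by rewrite /= exprE prim_expr_order // eqxx (prim_order_gt0 m_prim).
apply/and3P; split.
- rewrite coprime_sym prime_coprime //; apply: contraTN g_prim => pg.
  have /eqP->: (g%:R : 'F_p) == 0 by rewrite -[0]/(0%:R) eqr_Fp_nat mod0n.
  apply/negP => /prim_expr_order/eqP.
  by rewrite expr0n gtn_eqF // eq_sym oner_eq0.
- by rewrite prim_expr_order.
- apply/forallP => k; apply/implyP => k_gt0.
  by rewrite exprE -(prim_order_dvd g_prim) gtnNdvd.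
Qed.

Lemma card_Fp_pred : #|'F_p|.-1 = p.-1. Proof. by rewrite card_Fp. Qed.

(** If g^h = w^j, comparing orders gives n / gcd(n, h) = n / gcd(n, j). Conversely, equal gcds yield
    a unit t with t h = j modulo n, and g = w^t is a primitive root. *)
Lemma prim_root_powerE (w : 'F_p) (h : nat) :
    p.-1.-primitive_root w -> (0 < h < p)%N ->
  [exists g : 'I_p, (0 < g) && prim_root p g && (expn g h == h %[mod p])]%N
    = (gcdn p.-1 h == gcdn p.-1 (dlog w h%:R)).
Proof.
move=> w_prim /andP[h_gt0 h_lt]; set j := dlog w _.
have n_gt0 := prim_order_gt0 w_prim.
have wj: w ^+ j = h%:R.
  rewrite dlogK ?card_Fp_pred // -[0]/(0%:R) eqr_Fp_nat mod0n.
  by rewrite -/(dvdn _ _) gtnNdvd.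
apply/existsP/eqP => [[g /andP[/andP[_]]]|].
  rewrite prim_rootE -eqr_Fp_nat natrX -wj => g_prim /eqP gh.
  have := exp_prim_root g_prim h; rewrite gh.
  have := exp_prim_root w_prim j => ord_j ord_h.
  apply: (@divn_inj_dvd p.-1); rewrite ?dvdn_gcdl //.
  rewrite ![gcdn p.-1 _]gcdnC; apply/eqP.
  rewrite eqn_dvd (prim_order_dvd ord_j) prim_expr_order ?eqxx //=.
  by rewrite (prim_order_dvd ord_h) prim_expr_order.
move=> gcd_eq; have [t t_coprime th] := gcdn_eq_unit_mul n_gt0 h_gt0 gcd_eq.
have g_lt: (val (w ^+ t)%R < p)%N by rewrite -[X in (_ < X)%N](Fp_cast p_pr) ltn_ord.
have g_nat: ((val (w ^+ t))%:R : 'F_p) = w ^+ t by rewrite natr_Zp.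
have g_prim : p.-1.-primitive_root (w ^+ t).
  by have := exp_prim_root w_prim t; rewrite (eqP t_coprime) divn1.
exists (Ordinal g_lt); rewrite /= prim_rootE g_nat g_prim andbT.
rewrite -eqr_Fp_nat natrX g_nat -exprM -wj (eq_prim_root_expr w_prim) th eqxx andbT.
(* The representative of w^t is nonzero because its power of exponent p - 1 is 1. *)
rewrite lt0n; apply/eqP => g0; have := prim_expr_order g_prim.
by rewrite -g_nat /= g0 expr0n gtn_eqF // => /eqP; rewrite eq_sym oner_eq0.
Qed.

Lemma G_PR_ANYE (w : 'F_p) : p.-1.-primitive_root w ->
  G_PR_ANY p =
    (\sum_(1 <= h < p.-1.+1) (gcdn p.-1 h == gcdn p.-1 (dlog w h%:R)))%N.
Proof.
move=> w_prim; rewrite prednK ?prime_gt0 // /G_PR_ANY cardsE -sum1_card.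
rewrite [RHS]big_nat_cond.
rewrite (eq_bigr (fun h => if (gcdn p.-1 h == gcdn p.-1 (dlog w h%:R)) then 1 else 0)%N);
  last by move=> h _; case: eqP.
rewrite -big_mkcondr /=.
rewrite (eq_bigl (fun i : 'I_p => (fun h => (0 < h) && (gcdn p.-1 h == gcdn p.-1 (dlog w h%:R)))%N i)); last first.
  move=> h; rewrite unfold_in /=; case: posnP => //= h_gt0.
  by rewrite (prim_root_powerE w_prim) // h_gt0 ltn_ord.
rewrite -(big_mkord (fun h => (0 < h) && (gcdn p.-1 h == gcdn p.-1 (dlog w h%:R)))%N (fun=> 1%N)).
have p_gt0 := prime_gt0 p_pr; rewrite big_ltn_cond // ltnn.
rewrite andFb [LHS]big_nat_cond.
by apply: eq_bigl => h; case: h => //= h; rewrite andbT.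
Qed.

End PrimeField.

(** * Multiples in a multiplicative subgroup *)

Section PowerSubgroup.

Variables (F : finFieldType) (w : F) (r : nat).
Hypotheses (w_prim : #|F|.-1.-primitive_root w) (r_dvd : (r %| #|F|.-1)%N).

Definition unity_roots : {set F} := [set x | x ^+ r == 1].

Lemma unity_roots_order_gt0 : (0 < r)%N.
Proof. exact: dvdn_gt0 (prim_order_gt0 w_prim) r_dvd. Qed.

Lemma zero_notin_unity_roots : 0 \notin unity_roots.
Proof. by rewrite inE expr0n gtn_eqF ?unity_roots_order_gt0 // eq_sym oner_eq0. Qed.

Lemma card_unity_roots : #|unity_roots| = r.
Proof.
have z_prim := dvdn_prim_root w_prim r_dvd; set z := w ^+ _ in z_prim.
have ->: unity_roots = [set z ^+ nat_of_ord i | i in 'I_r].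
  apply/setP => x; rewrite inE; apply/eqP/imsetP => [/(prim_rootP z_prim)[i ->]|[i _ ->]].
    by exists i.
  by rewrite exprAC (prim_expr_order z_prim) expr1n.
rewrite card_imset ?card_ord // => i j /eqP.
by rewrite (eq_prim_root_expr z_prim) !modn_small // => /eqP/val_inj.
Qed.

Variable C : numClosedFieldType.

(** The weight r / (#|F| - 1) is the density of the subgroup among nonzero elements. Subtracting it
    makes the total vanish, and on nonzero arguments it supplies exactly the expected main term. *)
Definition centered (x : F) : C :=
  (x \in unity_roots)%:R - r%:R / #|F|.-1%:R * (x != 0)%:R.

Let order_neq0 : #|F|.-1%:R != 0 :> C.
Proof. by rewrite pnatr_eq0 -lt0n (prim_order_gt0 w_prim). Qed.

Let card_nonzero : #|[pred x : F | x != 0]| = #|F|.-1.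
Proof. by rewrite -(cardC1 (0 : F)); apply: eq_card => x; rewrite !inE. Qed.

Lemma sum_mem (P : pred F) : \sum_x (P x)%:R = #|P|%:R :> C.
Proof.
rewrite -sum1_card natr_sum [RHS]big_mkcond; apply: eq_bigr => x _.
by rewrite unfold_in; case: (P x).
Qed.

Lemma centeredM y x : y \in unity_roots -> centered (y * x) = centered x.
Proof.
move=> yH; have y_neq0: y != 0 by apply: contraNneq zero_notin_unity_roots => <-.
rewrite /centered !inE exprMn mulf_eq0 (negPf y_neq0) /=.
by move: yH; rewrite inE => /eqP->; rewrite mul1r.
Qed.

Lemma sum_centered : \sum_x centered x = 0.
Proof.
rewrite sumrB -mulr_sumr (sum_mem (mem unity_roots)) sum_mem.
by rewrite card_nonzero card_unity_roots divfK ?subrr.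
Qed.

(** As 0 lies outside the subgroup, the cross term only involves its indicator. With q the density,
    the sum is r (1 - 2 q) + r q = r (1 - q). *)
Lemma sum_sqr_centered_le : \sum_x `|centered x| ^+ 2 <= r%:R.
Proof.
set q : C := r%:R / #|F|.-1%:R.
have q_ge0 : 0 <= q by rewrite divr_ge0.
have sqr_centered x : `|centered x| ^+ 2 =
    (x \in unity_roots)%:R * (1 - 2 * q) + q ^+ 2 * (x != 0)%:R.
  rewrite /centered -/q real_normK; last by apply: realB; [exact: realn | apply: realM; [exact: ger0_real | exact: realn]].
  have [xH|_] := boolP (x \in unity_roots).
    have ->: x != 0 by apply: contraNneq zero_notin_unity_roots => <-.
    by rewrite /=; ring.
  by case: (x != 0); rewrite /=; ring.
rewrite (eq_bigr _ (fun x _ => sqr_centered x)).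
rewrite big_split -mulr_sumr -mulr_suml /= (sum_mem (mem unity_roots)) sum_mem.
rewrite card_nonzero card_unity_roots.
have ->: q ^+ 2 * #|F|.-1%:R = r%:R * q by rewrite expr2 -mulrA [q * #|F|.-1%:R]divfK // mulrC.
rewrite -mulrDr -[leRHS]mulr1 ler_wpM2l //.
have ->: 1 - 2 * q + q = 1 - q by ring.
by rewrite gerBl.
Qed.

Variable psi : F -> C.
Hypothesis psiD : forall x y, psi (x + y) = psi x * psi y.
Hypothesis norm_psi : forall x, `|psi x| = 1.
Hypothesis sum_psi : \sum_x psi x = 0.

Lemma fourier_centered0 : fourier psi centered 0 = 0.
Proof.
rewrite -sum_centered; apply: eq_bigr => x _.
by rewrite mul0r (psi0 psiD norm_psi) mulr1.
Qed.

(** [fourier_invariant_le] and the previous bound give r times the squared modulus at most [#|F|]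
    times r; the factor r cancels. *)
Lemma norm_fourier_centered a : a != 0 ->
  `|fourier psi centered a| <= sqrtC #|F|%:R.
Proof.
move=> a_neq0; rewrite -(@ler_pXn2r _ 2) ?nnegrE ?sqrtC_ge0 ?ler0n // sqrtCK.
have r_gt0 : 0 < r%:R :> C by rewrite ltr0n unity_roots_order_gt0.
rewrite -(ler_pM2l r_gt0) -{1}card_unity_roots.
apply: le_trans (fourier_invariant_le psiD norm_psi sum_psi
  zero_notin_unity_roots (fun y x => @centeredM y x) a_neq0) _.
by rewrite mulrC ler_wpM2r // sum_sqr_centered_le.
Qed.

Lemma sum_centered_le (I : Type) (s : seq I) (f : I -> F) :
  #|F|%:R * `|\sum_(i <- s) centered (f i)|
    <= sqrtC #|F|%:R * \sum_(a | a != 0) `|\sum_(i <- s) psi (a * f i)|.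
Proof.
exact: (sum_fourier_le psiD norm_psi sum_psi s f fourier_centered0
  norm_fourier_centered).
Qed.

End PowerSubgroup.

(** * Additive characters modulo p and the Polya-Vinogradov bound *)

Lemma big_dvdn_multiples (V : nmodType) (G : nat -> V) (u m : nat) :
    (0 < u)%N ->
  \sum_(1 <= h < (m * u).+1 | (u %| h)%N) G h = \sum_(1 <= i < m.+1) G (u * i)%N.
Proof.
move=> u_gt0; rewrite !big_add1 /=; elim: m => [|m IHm].
  by rewrite mul0n !big_geq.
rewrite big_nat_recr //= -IHm mulSnr (big_cat_nat (n := (m * u)%N)) ?leq_addr //=.
congr (_ + _); rewrite -[X in index_iota X]add0n big_addn addKn.
case: u u_gt0 {IHm} => // u _; rewrite big_mkcond big_nat_recr //= big1_seq.
  by rewrite add0r -addSn addnC -mulSnr dvdn_mull // mulnC.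
move=> i; rewrite mem_index_iota /= => i_lt.
by rewrite -addSn dvdn_addl ?dvdn_mull // gtnNdvd.
Qed.

Lemma half_inv_ratio_add (K : numFieldType) (b p : nat) : (0 < b < p)%N ->
  2^-1 * ((b%:R / p%:R)^-1 + (1 - b%:R / p%:R)^-1)
    = p%:R / 2 * (b%:R^-1 + (p - b)%:R^-1) :> K.
Proof.
move=> /andP[b_gt0 b_lt]; have p_neq0 : p%:R != 0 :> K.
  by rewrite pnatr_eq0 -lt0n (leq_trans _ b_lt).
have -> : 1 - b%:R / p%:R = (p - b)%:R / p%:R :> K.
  by rewrite natrB 1?ltnW // mulrBl divff.
by rewrite !invf_div -mulrDr mulrCA mulrA.
Qed.

(** The reflection b -> p - b shows that both halves have the same sum. *)
Lemma sum_inv_add_rev (K : numFieldType) (p : nat) :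
  \sum_(1 <= b < p) (p%:R / 2 * (b%:R^-1 + (p - b)%:R^-1))
    = p%:R * \sum_(1 <= b < p) b%:R^-1 :> K.
Proof.
rewrite -mulr_sumr big_split /= [X in _ + X]big_nat_rev /=.
under [X in _ + X]eq_big_nat => b /andP[_ b_lt] do
  rewrite add1n subSS subKn ?(ltnW b_lt) //.
by rewrite -mulr2n -[X in _ * X = _]mulr_natl mulrA divfK ?pnatr_eq0.
Qed.

Section CharacterSums.

Variable p : nat.
Hypothesis p_pr : prime p.

Lemma sum_Fp (V : nmodType) (G : nat -> V) :
  \sum_(x : 'F_p) G x = \sum_(0 <= k < p) G k.
Proof. by rewrite -[p in RHS](Fp_cast p_pr) big_mkord. Qed.

Lemma sum_Fp_neq0 (V : zmodType) (G : nat -> V) :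
  \sum_(x : 'F_p | x != 0) G x = \sum_(1 <= k < p) G k.
Proof.
apply: (addrI (G 0%N)); rewrite -[RHS]big_ltn ?prime_gt0 // -sum_Fp.
by rewrite [RHS](bigD1 0).
Qed.

Local Notation theta := (PI / p%:R : R).

(** This is exp(2 PI i x / p), with x read as its representative below p. The angle is written as
    twice theta because the geometric sum bound is stated in the half angle. *)
Definition additive_char (x : 'F_p) : R[i] := expi (theta *+ 2) ^+ x.

Let p_gt0 : 0 < p%:R :> R. Proof. by rewrite ltr0n prime_gt0. Qed.
Let p_neq0 : p%:R != 0 :> R. Proof. by rewrite pnatr_eq0 -lt0n prime_gt0. Qed.

Lemma sin_theta_le (b : nat) : (0 < b < p)%N ->
  0 < sin (theta *+ b) /\
  (sin (theta *+ b))^-1 <= p%:R / 2 * (b%:R^-1 + (p - b)%:R^-1).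
Proof.
move=> /andP[b_gt0 b_lt].
have x_gt0 : 0 < b%:R / p%:R :> R by apply: divr_gt0; rewrite // ltr0n.
have x_lt1 : b%:R / p%:R < 1 :> R by rewrite ltr_pdivrMr // mul1r ltr_nat.
have -> : theta *+ b = PI * (b%:R / p%:R) by rewrite -[LHS]mulr_natr -[LHS]mulrA [_^-1 * _]mulrC.
have PI_gt0 : 0 < PI :> R by apply/RltP/PI_RGT_0.
split.
  apply/RltP/sin_gt_0; apply/RltP; first exact: mulr_gt0.
  by rewrite -[ltRHS]mulr1 ltr_pM2l.
apply: le_trans (inv_sin_PI_ler x_gt0 x_lt1) _.
by rewrite half_inv_ratio_add // b_gt0.
Qed.


Lemma expi_theta_expr_p : expi (theta *+ 2) ^+ p = 1.
Proof.
rewrite expiX -mulrnA mulnC mulrnA.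
have -> : theta *+ p = PI by rewrite -[LHS]mulr_natr divfK.
by rewrite mulr2n -[_ + _]/(Rplus PI PI) -RIneq.double /expi cos_2PI sin_2PI.
Qed.

Lemma additive_char_nat k : additive_char k%:R = expi (theta *+ 2) ^+ k.
Proof. by rewrite /additive_char val_Fp_nat // (expr_mod _ expi_theta_expr_p). Qed.

Lemma additive_charD x y : additive_char (x + y) = additive_char x * additive_char y.
Proof.
rewrite -[x]natr_Zp -[y]natr_Zp -natrD !additive_char_nat.
by rewrite exprD.
Qed.

Lemma norm_additive_char x : `|additive_char x| = 1.
Proof. by rewrite normrX norm_expi expr1n. Qed.

Lemma additive_char_natM (a : 'F_p) i :
  additive_char (a * i%:R) = expi ((theta *+ a) *+ 2) ^+ i.
Proof.
rewrite -{1}[a]natr_Zp -natrM additive_char_nat exprM [in LHS]expiX.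
by rewrite -!mulrnA mulnC.
Qed.

(** For z = exp(2 PI i / p), (z - 1) times the sum is z^p - 1 = 0, and z != 1 because sin(PI / p) >
    0. *)
Lemma sum_additive_char : \sum_x additive_char x = 0.
Proof.
rewrite (sum_Fp (fun k => expi (theta *+ 2) ^+ k)) big_mkord.
have [sin_gt0 _] := sin_theta_le (b := 1) (prime_gt1 p_pr).
have := subrX1 (expi (theta *+ 2)) p; rewrite expi_theta_expr_p subrr.
move/esym/eqP; rewrite mulf_eq0 => /orP[|/eqP//]; rewrite -normr_eq0 distrC.
rewrite mulr1n in sin_gt0; rewrite norm_1_sub_expi => /eqP[/eqP].
by rewrite normr_eq0 mulf_eq0 pnatr_eq0 /= gt_eqF.
Qed.

(** Each frequency b is bounded by 1 / sin(PI b / p), independently of M, and the resulting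
    reciprocals add up to p times a harmonic sum. *)
Lemma sum_norm_geometric_le M :
  \sum_(a : 'F_p | a != 0) `|\sum_(1 <= i < M.+1) additive_char (a * i%:R)|
    <= (p%:R * (1 + ln p%:R))%:C%C.
Proof.
under eq_bigr do under eq_bigr do rewrite additive_char_natM.
rewrite (sum_Fp_neq0 (fun k => `|\sum_(1 <= i < M.+1) expi ((theta *+ k) *+ 2) ^+ i|)).
apply: (@le_trans _ _ (\sum_(1 <= b < p) (p%:R / 2 * (b%:R^-1 + (p - b)%:R^-1))%:C%C)).
  apply: ler_sum_nat => b /sin_theta_le[sin_gt0 inv_le].
  by apply: le_trans (norm_geometric_sum_le M sin_gt0) _; rewrite lecR.
rewrite -rmorph_sum lecR sum_inv_add_rev ler_wpM2l ?ler0n //.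
exact: harmonic_lt_le (prime_gt1 p_pr).
Qed.

Lemma sqrtC_natr (m : nat) : sqrtC m%:R = (Num.sqrt m%:R)%:C%C :> R[i].
Proof.
rewrite -[RHS]sqrCK ?ler0c ?sqrtr_ge0 //.
by rewrite -rmorphXn /= sqr_sqrtr ?ler0n // rmorph_nat.
Qed.

Lemma normc_real (x : R) : `|x%:C%C| = `|x|%:C%C.
Proof. by rewrite normc_def /= expr0n addr0 sqrtr_sqr. Qed.

Variable w : 'F_p.
Hypothesis w_prim : p.-1.-primitive_root w.

Lemma dvdn_dlog_equidistributed u v : (u %| p.-1)%N -> (v %| p.-1)%N ->
  `|\sum_(1 <= h < p.-1.+1) (u %| h)%:R * (v %| dlog w h%:R)%:R
      - (p.-1 %/ u)%:R * (p.-1 %/ v)%:R / p.-1%:R|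
    <= Num.sqrt p%:R * (1 + ln p%:R) :> R.
Proof.
move=> u_dvd v_dvd; have n_gt0 := prim_order_gt0 w_prim.
have w_primF : #|'F_p|.-1.-primitive_root w by rewrite card_Fp_pred.
have r_dvd : (p.-1 %/ v %| #|'F_p|.-1)%N.
  by rewrite card_Fp_pred // dvdn_div.
set M := (p.-1 %/ u)%N; set r := (p.-1 %/ v)%N in r_dvd *; set X := (X in `|X|).
have u_gt0 : (0 < u)%N := dvdn_gt0 n_gt0 u_dvd.
have n_def : p.-1 = (M * u)%N by rewrite divnK.
(* The M multiples u i are nonzero in F_p, so each carries the same constant r / (p - 1), and M
   copies of it form the main term. *)
have X_centered : X%:C%C = \sum_(1 <= i < M.+1) centered r R[i] ((u * i)%:R : 'F_p).
  have multiples_neq0 i : (1 <= i < M.+1)%N -> ((u * i)%:R : 'F_p) != 0.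
    move=> /andP[i_gt0 i_le]; rewrite -[0]/(0%:R) eqr_Fp_nat // mod0n.
    rewrite -/(dvdn _ _) gtnNdvd ?muln_gt0 ?u_gt0 //.
    by rewrite -(prednK (prime_gt0 p_pr)) ltnS n_def mulnC leq_mul2r -ltnS i_le orbT.
  have -> : \sum_(1 <= i < M.+1) centered r R[i] ((u * i)%:R : 'F_p) =
      \sum_(1 <= i < M.+1) ((v %| dlog w (u * i)%:R)%:R - r%:R / p.-1%:R).
    apply: eq_big_nat => i /multiples_neq0 i_neq0.
    rewrite /centered i_neq0 mulr1 card_Fp // inE.
    by rewrite (dvdn_expr_eq1 _ n_gt0 v_dvd w_prim) dlogK.
  rewrite sumrB sumr_const_nat subSS subn0.
  rewrite -(big_dvdn_multiples (fun h => (v %| dlog w h%:R)%:R : R[i]) M u_gt0) -n_def.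
  rewrite rmorphB rmorph_sum !rmorphM fmorphV !rmorph_nat -mulrA mulr_natl.
  congr (_ - _); rewrite [RHS]big_mkcond; apply: eq_bigr => h _.
  by rewrite rmorphM !rmorph_nat; case: (u %| h)%N; rewrite ?mul1r ?mul0r.
have p_gt0C : 0 < p%:R :> R[i] by rewrite ltr0n prime_gt0.
rewrite -lecR -normc_real X_centered -(ler_pM2l p_gt0C).
have := sum_centered_le w_primF r_dvd additive_charD norm_additive_char
  sum_additive_char (index_iota 1 M.+1) (fun i => (u * i)%:R).
rewrite card_Fp // sqrtC_natr => /le_trans; apply.
have -> : p%:R * (Num.sqrt p%:R * (1 + ln p%:R))%:C%C =
    (Num.sqrt p%:R)%:C%C * (p%:R * (1 + ln p%:R))%:C%C :> R[i].
  by rewrite !rmorphM rmorph_nat mulrCA.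
rewrite ler_wpM2l ?ler0c ?sqrtr_ge0 //.
apply: le_trans (sum_norm_geometric_le M).
have u_neq0 : (u%:R : 'F_p) != 0.
  rewrite -[0]/(0%:R) eqr_Fp_nat // mod0n -/(dvdn _ _) gtnNdvd //.
  by rewrite -(prednK (prime_gt0 p_pr)) ltnS dvdn_leq.
(* As u is invertible modulo p, a -> a u permutes the nonzero frequencies, so the sums over u i
   reduce to sums over i. *)
rewrite [leRHS](reindex_onto (fun a => a * u%:R) (fun a => a / u%:R)) => [|a _]; last first.
  by rewrite divfK.
rewrite [leRHS](eq_bigl (fun a => a != 0)) => [|a]; last first.
  by rewrite mulfK // eqxx andbT mulf_eq0 (negPf u_neq0) orbF.
apply: ler_sum => a _; under eq_bigr do rewrite natrM mulrA.
exact: lexx.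
Qed.

End CharacterSums.

(** * The estimate for the number of solutions *)

Lemma G_PR_ANY_estimate (p : nat) : prime p ->
  `|(G_PR_ANY p)%:R
      - p.-1%:R^-1 * (\sum_(e <- divisors p.-1) totient (p.-1 %/ e) ^ 2)%N%:R|
    <= (size (divisors p.-1))%:R ^+ 3 * (Num.sqrt p%:R * (1 + ln p%:R)) :> R.
Proof.
move=> p_pr; have [|w] := @exists_prim_root 'F_p.
  by rewrite card_Fp // prime_gt1.
rewrite card_Fp // => w_prim; rewrite (G_PR_ANYE p_pr w_prim) natr_sum.
(* Here [ind] is the discrete logarithm to base w and E is sqrt p (1 + ln p). *)
apply: card_equal_gcdn; first exact: prim_order_gt0 w_prim.
by move=> u v; apply: dvdn_dlog_equidistributed.
Qed.

Local Close Scope ring_scope.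

Theorem mainTheorem3 (p : nat) (hp : prime p) (hodd : odd p) :
  Rle (Rabs (Rminus (INR (G_PR_ANY p)) (main_term p)))
      (Rmult (Rmult (pow (INR (numdiv (p - 1))) 3) (sqrt (INR p)))
             (Rplus R1 (ln (INR p)))).
Proof.
have /RleP := G_PR_ANY_estimate hp.
rewrite /main_term /numdiv !subn1 RabsE RpowE RsqrtE !INRE.
by rewrite mulrA.
Qed.
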